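(* For every integer $t \ge 2$ there exists a real constant $c_t > 0$ such that for every directed graph $D$ and every function $f : V(D) \to \mathbb{Z}_{\ge 2}$ with maximum value at most $t$, we have $$\vec{a}_f(D) \le d + c_t d^{3/4} (\log d)^{1/2},$$ where $d = \max\{\Delta^-(D), \Delta^+_{f-1}(D)\}$.
   Context: A directed graph has no loops and no parallel arcs (two arcs with the same tail and same head), but may have anti-parallel arcs. $\Delta^-(D)$ is the maximum indegree; $\Delta^+_{f-1}(D) = \max_{v \in V(D)} \lceil d^+(v)/(f(v)-1) \rceil$, where $d^+(v)$ is the outdegree. A branching is a directed graph in which every vertex has indegree at most $1$ and whose underlying undirected graph is a forest. A degree-$f$ branching of $D$ is a spanning subgraph $B$ of $D$ that is a branching in which every vertex $v$ has outdegree at most $f(v)-1$. The directed degree-$f$ arboricity $\vec{a}_f(D)$ is the minimum number of colors in an arc-coloring of $D$ in which every color class is a degree-$f$ branching.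
   Formalization: The case d = 1 is excluded: there log d = 0 and the bound reads 1, but a directed triangle with f = 2 has d = 1 and needs two colors. For d = 0 the error term is read as 0. *)

(* Defs.v *)
From mathcomp Require Import all_boot.
From mathcomp Require Import boolp.

Set Implicit Arguments.
Unset Strict Implicit.
Unset Printing Implicit Defensive.

Record digraph := Digraph {
  vertex :> finType;
  arc : rel vertex;
  arc_irr : irreflexive arc }.

Section ArcRelations.
Variables (V : finType) (e : rel V).

Definition indeg (v : V) : nat := #|[set u | e u v]|.
Definition outdeg (v : V) : nat := #|[set w | e v w]|.

Definition joins (a : V * V) (x y : V) : bool := (a == (x, y)) || (a == (y, x)).

(* p = x_0, ..., x_(k-1) and q = a_0, ..., a_(k-1) (k > 0) list the vertices   *)
(* and the edges of a cycle of the underlying undirected multigraph: a_i is    *)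
(* an arc of e, read as an edge joining x_i to x_(i+1 mod k). Arcs keep their  *)
(* identity as edges, so a pair of anti-parallel arcs is a cycle with k = 2.   *)
Definition underlying_cycle (p : seq V) (q : seq (V * V)) : bool :=
  [&& p != [::], uniq p, uniq q &
      all2 (fun a xy => e a.1 a.2 && joins a xy.1 xy.2) q (zip p (rot 1 p))].

Definition underlying_forest : Prop :=
  forall (p : seq V) (q : seq (V * V)), ~~ underlying_cycle p q.

Definition branching : Prop :=
  (forall v, indeg v <= 1) /\ underlying_forest.

Definition degree_branching (f : V -> nat) : Prop :=
  branching /\ forall v, outdeg v <= f v - 1.

End ArcRelations.

Definition color_class (D : digraph) (c : D * D -> nat) (i : nat) : rel D :=
  [rel u v | arc u v && (c (u, v) == i)].

(* c is a colouring of the arcs only: its values on other pairs are irrelevant, *)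
(* so that an arcless digraph is colourable with k = 0 colours.                 *)
Definition arborically_colorable (D : digraph) (f : D -> nat) (k : nat) : Prop :=
  exists c : D * D -> nat,
    (forall u v : D, arc u v -> c (u, v) < k) /\
    (forall i, i < k -> degree_branching (color_class c i) f).

Lemma arborically_colorable_ex (D : digraph) (f : D -> nat) :
  (forall v, 2 <= f v) -> exists k, `[< arborically_colorable f k >].
Proof.
move=> f_ge2; exists #|{: D * D}|; apply/asboolP.
pose c (b : D * D) : nat := enum_rank b.
exists c; split=> [u v _|i ltik]; first exact: ltn_ord.
pose a := enum_val (Ordinal ltik).
have classE (u v : D) : color_class c i u v -> (u, v) = a.
  case/andP=> _ /eqP Di; apply: enum_rank_inj.
  by rewrite /a enum_valK; apply: val_inj.
split; first split.
- move=> v; apply: leq_trans (_ : #|[set a.1]| <= 1); last by rewrite cards1.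
  by apply/subset_leq_card/subsetP=> u; rewrite !inE => /classE <-.
- move=> p q; apply/negP=> /and4P[p_neq0 _ q_uniq].
  case: p p_neq0 => // x p _; rewrite rot1_cons.
  case: q q_uniq => [|b q] q_uniq; first by case: p.
  case: p => [|y p] /=.
    rewrite /joins orbb => /andP[/andP[/andP[arcb _] /eqP Db] _].
    by move: arcb; rewrite Db /= arc_irr.
  case/andP=> /andP[/classE Db _].
  case: q q_uniq => [|b' q] q_uniq; first by case: p.
  have E (b0 : D * D) : (b0.1, b0.2) = b0 by case: b0.
  have [z [s ->]] : exists z s, zip (y :: p) (rcons p x) = z :: s.
    by case: p => [|z p]; do 2 eexists.
  case/andP=> /andP[/classE Db' _] _.
  by move: q_uniq; rewrite /= inE -(E b) -(E b') Db Db' eqxx.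
- move=> v; apply: leq_trans (_ : 1 <= f v - 1); last by rewrite subn_gt0 f_ge2.
  apply: leq_trans (_ : #|[set a.2]| <= 1); last by rewrite cards1.
  by apply/subset_leq_card/subsetP=> u; rewrite !inE => /classE <-.
Qed.

(* The minimum exists because f >= 2: colour all arcs differently. *)
Definition directed_arboricity (D : digraph) (f : D -> nat)
    (f_ge2 : forall v, 2 <= f v) : nat :=
  ex_minn (arborically_colorable_ex f_ge2).

Definition ceil_div (m n : nat) : nat := (m + n.-1) %/ n.

Lemma ceil_div_leq (m n k : nat) : 0 < n -> (ceil_div m n <= k) = (m <= k * n).
Proof.
case: n => // n _; rewrite /ceil_div -ltnS ltn_divLR //= mulSn.
by rewrite addSn ltnS [n + _]addnC leq_add2r.
Qed.

Definition max_indeg (D : digraph) : nat := \max_(v : D) indeg (@arc D) v.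

Definition max_outdeg_ratio (D : digraph) (f : D -> nat) : nat :=
  \max_(v : D) ceil_div (outdeg (@arc D) v) (f v - 1).

Definition degree_parameter (D : digraph) (f : D -> nat) : nat :=
  maxn (max_indeg D) (max_outdeg_ratio f).

(* Main.v *)
Require Import Defs.
From mathcomp Require Import all_boot all_order all_algebra.
From mathcomp Require Import boolp reals sequences exp.
From mathcomp Require Import zify ring lra.

(** Colour the vertices at random with an even number [p], of order
    [sqrt d], of colours. By the local lemma and a Chernoff bound one may
    assume that every vertex [v] has at most [k = d/p + O(sqrt (d/p * log d))]
    in-neighbours and [(f v - 1) * k] out-neighbours of each colour (since
    [d/p] and [p] are both of order [sqrt d], the deviation is written below as
    [6 * d^(1/4) * sqrt (log d)]).

    The complete digraph on the colours [Z/p] decomposes into [p] Hamiltonian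
    paths, the translates of the zigzag 0, 1, -1, 2, -2, ... Pull this
    decomposition back to [D]: the arcs whose pair of colours lies on one path
    form an acyclic digraph with indegrees at most [k] and outdegrees at most
    [(f v - 1) * k]. By König's edge colouring theorem, applied after splitting
    the tails, it is the union of [k] digraphs with indegrees at most 1 and
    outdegrees at most [f v - 1], and an acyclic digraph with indegrees at most
    1 is a branching. The arcs joining vertices of equal colour are decomposed
    greedily into [O(t * k)] matchings. Altogether [p * k + O(t * k)] colours
    are used. *)

Set Implicit Arguments.
Unset Strict Implicit.
Unset Printing Implicit Defensive.

(** * The zigzag decomposition of the complete digraph *)

Definition shift m a b := if a < b then b - a else b + m.*2 - a.

(* The path [s] visits s, s + 1, s - 1, s + 2, s - 2, ... modulo [2 * m]. Its
   successive differences 1, -2, 3, -4, ... run through all nonzero residues,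
   so the difference [b - a] determines the rank of the arc [(a, b)] on its
   path, and then [a] determines [s]. *)
Definition zigzag m a b :=
  let s := a + (shift m a b)./2 + (if odd (shift m a b) then 0 else m) in
  if s < m.*2 then s else s - m.*2.

(** The modulus is even, so residues have a parity: an odd difference [r] is the forward step of
    rank [r - 1], an even one the backward step by [m.*2 - r], with ranks counted from 0. *)
Definition zigzag_rank m a b :=
  if odd (shift m a b) then (shift m a b).-1 else (m.*2 - shift m a b).-1.

Ltac case_ifs :=
  repeat match goal with
  | |- context [if ?b then _ else _] =>
    lazymatch b with context [if _ then _ else _] => fail | _ => destruct b eqn:? end
  end.

Lemma zigzag_lt m a b : a < m.*2 -> b < m.*2 -> a != b -> zigzag m a b < m.*2.
Proof. rewrite /zigzag /shift => *; case_ifs; lia. Qed.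

(** A path visits [a] once and so has at most one arc out of it. In the pullback, the out-neighbours
    of a vertex along one path thus share a colour. *)
Lemma zigzag_injr m a b b' : a < m.*2 -> b < m.*2 -> b' < m.*2 ->
  a != b -> a != b' -> zigzag m a b = zigzag m a b' -> b = b'.
Proof. rewrite /zigzag /shift => la la' lb n n'; case_ifs; lia. Qed.

Lemma zigzag_injl m a a' b : a < m.*2 -> a' < m.*2 -> b < m.*2 ->
  a != b -> a' != b -> zigzag m a b = zigzag m a' b -> a = a'.
Proof. rewrite /zigzag /shift => la la' lb n n'; case_ifs; lia. Qed.

Lemma zigzag_rank_lt m a b b' : a < m.*2 -> b < m.*2 -> b' < m.*2 ->
  a != b -> b != b' -> zigzag m a b = zigzag m b b' ->
  zigzag_rank m a b < zigzag_rank m b b'.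
Proof. rewrite /zigzag_rank /zigzag /shift => la la' lb n n'; case_ifs; lia. Qed.

(** * Forests *)

Lemma underlying_cycleP (V : finType) (e : rel V) (p : seq V) (q : seq (V * V)) x0 a0 :
  underlying_cycle e p q ->
  [/\ 0 < size p, size q = size p, uniq q & forall i, i < size p ->
    let a := nth a0 q i in e a.1 a.2 && joins a (nth x0 p i) (nth x0 p (i.+1 %% size p))].
Proof.
case: p => // x p /and4P[_ _ uq]; rewrite rot1_cons all2E => /andP[].
rewrite size_zip size_rcons minnn => /eqP sq /allP H; split=> // i ip.
have zi : i < size (zip (x :: p) (rcons p x)) by rewrite size_zip size_rcons minnn.
have := H (nth (a0, (x0, x0)) (zip q (zip (x :: p) (rcons p x))) i).
rewrite mem_nth ?size_zip ?sq ?size_rcons ?minnn // => /(_ isT).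
rewrite nth_zip ?size_zip ?size_rcons ?minnn // nth_zip ?size_rcons //=.
suff -> : nth x0 (rcons p x) i = nth x0 (x :: p) (i.+1 %% (size p).+1) by [].
rewrite nth_rcons; move: ip; rewrite ltnS leq_eqVlt => /orP[/eqP->|ip].
  by rewrite ltnn eqxx modnn.
by rewrite ip modn_small.
Qed.

(* In an underlying cycle take an arc [(u, v)] with [g] maximal. The other
   cycle edge at [v] cannot enter [v] and cannot leave it. *)
Lemma increasing_forest (V : finType) (e : rel V) (g : V * V -> nat) :
  (forall v, indeg e v <= 1) ->
  (forall u v w, e u v -> e v w -> g (u, v) < g (v, w)) ->
  underlying_forest e.
Proof.
move=> ind gP p q; apply/negP => cyc.
have /and4P[] := cyc; case: p cyc => // x0 p' cyc _ _ _ _.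
set p := x0 :: p' in cyc *.
have [p_gt0 sq uq qP] := underlying_cycleP x0 (x0, x0) cyc.
set k := size p in p_gt0 sq qP.
pose A i := nth (x0, x0) q i; pose X i := nth x0 p i.
case: (@arg_maxnP _ (Ordinal p_gt0) xpredT (fun i => g (A i)) isT) => -[i ik] _ /= imax.
have /= := qP i ik; rewrite -/(A i) -/(X i) -/(X _).
case DA: (A i) => [u v] /= /andP[euv jA].
suff [j [jk ji jv]] : exists j, [/\ j < k, j != i & (A j).1 = v \/ (A j).2 = v].
  have /andP[] := qP j jk; rewrite -/(A j) => ej _.
  have nA : A j != A i by rewrite nth_uniq ?sq.
  have := imax (Ordinal jk) isT; rewrite /= DA leqNgt => /negP; apply.
  move: ej nA; rewrite DA; case: (A j) jv => [u' w'] /= [->|->] ej; first by rewrite gP.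
  apply: contraNT => _; apply/eqP; congr pair.
  have := ind v; rewrite leqNgt; apply: contraNeq => uu'.
  apply: leq_trans (_ : #|[set u'; u]| <= _); first by rewrite cards2 uu'.
  by apply/subset_leq_card/subsetP=> z; rewrite !inE => /orP[]/eqP->.
(* A cycle of length 1 is a loop, which would follow itself and force [g] to exceed itself. *)
have k_gt1 : 1 < k.
  rewrite ltnNge; apply/negP => k1.
  have Dk : k = 1 by apply/eqP; rewrite eqn_leq k1.
  have i0 : i = 0 by move: ik; rewrite Dk; case: (i).
  move: jA; rewrite i0 Dk modn1 /joins orbb => /eqP[uX vX].
  have uv : u = v by rewrite uX vX.
  by rewrite uv in euv; have := gP v v v euv euv; rewrite ltnn.
have endp j : j < k -> (X j = v -> (A j).1 = v \/ (A j).2 = v) /\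
                       (X (j.+1 %% k) = v -> (A j).1 = v \/ (A j).2 = v).
  by move=> jk; have := qP j jk; rewrite /= -/(A j) => /andP[_ /orP[]/eqP->]; split=> <-; [left|right|right|left].
(* The arc runs along the cyclic order or against it, so the other edge at [v] is the next one or
   the previous one. *)
have [/eqP[_ vX]|/eqP[_ vX]] := orP jA.
- have jk : i.+1 %% k < k by rewrite ltn_mod.
  exists (i.+1 %% k); split; first by [].
    move: ik; rewrite leq_eqVlt => /orP[/eqP ik|ik]; last by rewrite modn_small; lia.
    by rewrite ik modnn; lia.
  by case: (endp _ jk) => + _; apply; rewrite vX.
- have jk : (if i == 0 then k.-1 else i.-1) < k by case: (i =P 0); lia.
  exists (if i == 0 then k.-1 else i.-1); split=> //; first by case: (i =P 0); lia.
  case: (endp _ jk) => _; apply; rewrite vX; congr X.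
  by case: (i =P 0) => [->|?]; rewrite prednK ?modnn ?modn_small //; lia.
Qed.

(** * Edge colourings *)

Lemma connect_last (T : finType) (r : rel T) x y :
  connect r x y -> y = x \/ exists2 z, connect r x z & r z y.
Proof.
case/connectP=> p; elim/last_ind: p => [|p z _] /=; first by left.
rewrite rcons_path last_rcons => /andP[pp rz] ->; right.
by exists (last x p) => //; apply/connectP; exists p.
Qed.

Lemma missing_color (E : finType) (S : {set E}) (c : E -> nat) k :
  #|S| < k -> exists2 i, i < k & {in S, forall e, c e != i}.
Proof.
move=> Sk; have [/'exists_forall_inP[i H]|] :=
  boolP [exists i : 'I_k, [forall (e | e \in S), c e != i]].
  by exists i => // e /H.
rewrite negb_exists => /forallP H.
suff: k <= #|S| by rewrite leqNgt Sk.
rewrite -[k]card_ord.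
have /fin_all_exists2[g gS gc] (i : 'I_k) : exists2 e, e \in S & c e == i.
  have := H i; rewrite negb_forall_in => /exists_inP[e eS]; rewrite negbK.
  by exists e.
apply: leq_trans (_ : #|[set g i | i : 'I_k]| <= _).
  by rewrite card_imset // => i j ij; apply: val_inj; rewrite /= -(eqP (gc i)) ij (eqP (gc j)).
by apply/subset_leq_card/subsetP => e /imsetP[i _ ->].
Qed.

Lemma greedy_coloring (E : finType) (r : rel E) k :
    symmetric r -> (forall e, #|[set e' | r e e']| < k) ->
  exists c : E -> nat,
    (forall e, c e < k) /\ (forall e e', e != e' -> r e e' -> c e != c e').
Proof.
move=> symr degk.
suff /(_ setT)[c [ck cP]] (S : {set E}) : exists c : E -> nat,
    {in S, forall e, c e < k} /\ {in S &, forall e e', e != e' -> r e e' -> c e != c e'}.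
  by exists c; split=> [e|e e']; [apply: ck | apply: cP].
have [n] := ubnP #|S|; elim: n => // n IH in S *; rewrite ltnS => Sn.
have [->|[e0 e0S]] := set_0Vmem S.
  by exists (fun=> 0); split=> e; rewrite inE.
have [|c [ck cP]] := IH (S :\ e0).
  by rewrite (leq_trans _ Sn) // [leqRHS](cardsD1 e0) e0S.
have [a ak aP] := missing_color c (degk e0).
exists (fun e => if e == e0 then a else c e); split=> [e eS | e e' eS eS' ee' re].
  by case: eqP => // /eqP ee0; apply: ck; rewrite !inE ee0.
case: (eqVneq e e0) => [De|ne]; case: (eqVneq e' e0) => [De'|ne'].
- by rewrite De De' eqxx in ee'.
- by rewrite eq_sym; apply: aP; rewrite inE -De.
- by apply: aP; rewrite inE -De' symr.
- by apply: cP; rewrite // !inE ?ne ?ne'.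
Qed.

Section Konig.
Variables (E : finType) (X Y : eqType) (x : E -> X) (y : E -> Y).

(** [E] is read as the edge set of a bipartite multigraph in which [e] joins [x e] to [y e]. *)
Definition proper_on (c : E -> nat) (k : nat) (S : {set E}) :=
  [/\ {in S, forall e, c e < k},
      {in S &, forall e e', c e = c e' -> x e = x e' -> e = e'} &
      {in S &, forall e e', c e = c e' -> y e = y e' -> e = e'}].

Lemma proper_add c k (S : {set E}) e0 a : e0 \notin S -> a < k -> proper_on c k S ->
  {in S, forall e, x e = x e0 -> c e != a} ->
  {in S, forall e, y e = y e0 -> c e != a} ->
  proper_on (fun e => if e == e0 then a else c e) k (e0 |: S).
Proof.
move=> e0S ak [ck cx cy] ax ay.
have neq e : e \in S -> (e == e0) = false.
  by move=> eS; apply: contraNF e0S => /eqP <-.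
split.
- by move=> e /setU1P[->|eS]; rewrite ?eqxx // neq // ck.
- move=> e e' /setU1P[->|eS] /setU1P[->|eS'] //; rewrite ?eqxx ?neq //.
  + by move=> /esym/eqP + /esym xe; rewrite (negbTE (ax _ eS' xe)).
  + by move=> /eqP + xe; rewrite (negbTE (ax _ eS xe)).
  + exact: cx.
- move=> e e' /setU1P[->|eS] /setU1P[->|eS'] //; rewrite ?eqxx ?neq //.
  + by move=> /esym/eqP + /esym xe; rewrite (negbTE (ay _ eS' xe)).
  + by move=> /eqP + xe; rewrite (negbTE (ay _ eS xe)).
  + exact: cy.
Qed.

(** Kempe's argument: [a] is free at [x e0] and [b] at [y e0]. Exchanging them along the alternating
    path from [y e0] frees [a] there too, and by bipartiteness the path never reaches [x e0]. *)
Lemma kempe_swap c k (S : {set E}) e0 a b :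
    a < k -> b < k -> proper_on c k S ->
    {in S, forall e, x e = x e0 -> c e != a} ->
    {in S, forall e, y e = y e0 -> c e != b} ->
  exists c' : E -> nat, [/\ proper_on c' k S,
    {in S, forall e, x e = x e0 -> c' e != a} &
    {in S, forall e, y e = y e0 -> c' e != a}].
Proof.
move=> ak bk [ck cx cy] ax by_.
have [/exists_inP[e1 e1S /andP[/eqP ye1 /eqP ce1]]|] :=
  boolP [exists (e | e \in S), (y e == y e0) && (c e == a)]; last first.
  rewrite negb_exists_in => /forall_inP noa; exists c; split=> // e eS ye.
  by have := noa e eS; rewrite ye eqxx.
have neq_ab : (b == a) = false.
  by apply: contraNF (by_ _ e1S ye1) => /eqP->; rewrite ce1.
(* [K] is the alternating path that starts at [y e0] with the edge [e1]; it
   enters every [x]-fibre by an edge coloured [a], hence avoids that of [e0]. *)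
pose r : rel E := [rel e e' | (e' \in S) &&
  ([&& c e == a, c e' == b & x e == x e'] ||
   [&& c e == b, c e' == a & y e == y e'])].
pose K := connect r e1.
have KS e : K e -> e \in S.
  by case/connect_last=> [->//|[z _ /andP[]]].
have Kab e : K e -> c e = a \/ c e = b.
  case/connect_last=> [->|[z _ /andP[_ /orP[]/and3P[_ /eqP-> _]]]]; by [left|right].
have Kb e : K e -> c e = b -> exists2 e', K e' & c e' = a /\ x e' = x e.
  case/connect_last=> [->|[z Kz /andP[_ /orP[]/and3P[/eqP cz /eqP ce /eqP E1]]]] Db.
  - by move: neq_ab; rewrite -Db ce1 eqxx.
  - by exists z.
  - by move: neq_ab; rewrite -Db ce eqxx.
have Ka e : K e -> c e = a -> e = e1 \/ exists2 e', K e' & c e' = b /\ y e' = y e.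
  case/connect_last=> [->|[z Kz /andP[_ /orP[]/and3P[/eqP cz /eqP ce /eqP E1]]]] Da.
  - by left.
  - by move: neq_ab; rewrite -Da ce eqxx.
  - by right; exists z.
(* [Kx] and [Ky] show that [K] absorbs every edge coloured [a] or [b] that shares an endpoint with
   it, so the swap creates no conflict. *)
have Kx e e' : K e -> e' \in S -> x e = x e' -> c e' = a \/ c e' = b -> K e'.
  have same z : K z -> e' \in S -> x z = x e' -> c z = c e' -> K e'.
    by move=> Kz eS xz cz; rewrite -(cx z e') //; apply: KS.
  move=> Ke eS xe ce'; case: (Kab e Ke) => ce; case: ce' => ce'.
  - by apply: (same e); rewrite ?ce.
  - by apply: connect_trans Ke (connect1 _); rewrite /r /= eS ce ce' xe !eqxx.
  - by have [e2 K2 [c2 x2]] := Kb e Ke ce; apply: (same e2); rewrite ?c2 ?x2.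
  - by apply: (same e); rewrite ?ce.
have Ky e e' : K e -> e' \in S -> y e = y e' -> c e' = a \/ c e' = b -> K e'.
  have same z : K z -> e' \in S -> y z = y e' -> c z = c e' -> K e'.
    by move=> Kz eS yz cz; rewrite -(cy z e') //; apply: KS.
  move=> Ke eS ye ce'; case: (Kab e Ke) => ce; case: ce' => ce'.
  - by apply: (same e); rewrite ?ce.
  - case: (Ka e Ke ce) => [De|[e2 K2 [c2 y2]]].
      by have := by_ e' eS; rewrite -ye De ye1 ce' eqxx => /(_ erefl).
    by apply: (same e2); rewrite ?c2 ?y2.
  - by apply: connect_trans Ke (connect1 _); rewrite /r /= eS ce ce' ye !eqxx orbT.
  - by apply: (same e); rewrite ?ce.
pose sw i := if i == a then b else a.
pose c' e := if K e then sw (c e) else c e.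
have Kc' e : K e -> c' e = a \/ c' e = b.
  by rewrite /c' /sw => ->; case: ifP; [right|left].
have sw_inj e e' : K e -> K e' -> sw (c e) = sw (c e') -> c e = c e'.
  by move=> /Kab[]-> /Kab[]->; rewrite /sw ?eqxx ?neq_ab // => E1; move: neq_ab; rewrite E1 eqxx.
exists c'; split; first split.
- by move=> e eS; rewrite /c' /sw; do 2?case: ifP => _ //; auto.
- move=> e e' eS eS' Dc xe; have [Ke|Ke] := boolP (K e); have [Ke'|Ke'] := boolP (K e').
  + by apply: cx => //; apply: sw_inj => //; move: Dc; rewrite /c' Ke Ke'.
  + have := Kc' e Ke; rewrite Dc {1 2}/c' (negbTE Ke') => H.
    by rewrite (Kx e e') in Ke'.
  + have := Kc' e' Ke'; rewrite -Dc {1 2}/c' (negbTE Ke) => H.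
    by rewrite (Kx e' e) in Ke.
  + by move: Dc; rewrite /c' (negbTE Ke) (negbTE Ke') => Dc; exact: cx.
- move=> e e' eS eS' Dc ye; have [Ke|Ke] := boolP (K e); have [Ke'|Ke'] := boolP (K e').
  + by apply: cy => //; apply: sw_inj => //; move: Dc; rewrite /c' Ke Ke'.
  + have := Kc' e Ke; rewrite Dc {1 2}/c' (negbTE Ke') => H.
    by rewrite (Ky e e') in Ke'.
  + have := Kc' e' Ke'; rewrite -Dc {1 2}/c' (negbTE Ke) => H.
    by rewrite (Ky e' e) in Ke.
  + by move: Dc; rewrite /c' (negbTE Ke) (negbTE Ke') => Dc; exact: cy.
- move=> e eS xe; rewrite /c'; case: ifP => Ke; last exact: ax.
  have ce : c e = b.
    by case: (Kab e Ke) => // ce; have := ax e eS xe; rewrite ce eqxx.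
  have [e2 K2 [c2 x2]] := Kb e Ke ce.
  by have := ax e2 (KS _ K2); rewrite x2 c2 eqxx => /(_ xe).
- move=> e eS ye; rewrite /c'; case: ifP => Ke.
    rewrite /sw; case: (c e =P a) => [_|ce]; first by rewrite neq_ab.
    case: (Kab e Ke) => // ce'; by have := by_ e eS ye; rewrite ce' eqxx.
  apply: contraFN Ke => /eqP ce; rewrite (_ : e = e1) //; first exact: connect0.
  by apply: cy => //; rewrite ?ce ?ye.
Qed.

(** Induction on the edges: without [e0], each of its endpoints misses one of the [k] colours, and a
    Kempe swap makes them miss the same one. *)
Lemma konig_coloring k (S : {set E}) :
    (forall u, #|[set e in S | x e == u]| <= k) ->
    (forall v, #|[set e in S | y e == v]| <= k) ->
  exists c, proper_on c k S.
Proof.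
have [n] := ubnP #|S|; elim: n => // n IH in S *; rewrite ltnS => Sn dx dy.
have [->|[e0 e0S]] := set_0Vmem S.
  by exists (fun=> 0); split=> e; rewrite inE.
have e0S' : e0 \notin S :\ e0 by rewrite !inE eqxx.
have sub (P : pred E) : #|[set e in S :\ e0 | P e]| <= #|[set e in S | P e]|.
  by apply/subset_leq_card/subsetP => e; rewrite !inE => /andP[/andP[_ ->] ->].
have sub1 (P : pred E) : P e0 -> #|[set e in S :\ e0 | P e]| < #|[set e in S | P e]|.
  move=> Pe; apply/proper_card/properP; split.
    by apply/subsetP => e; rewrite !inE => /andP[/andP[_ ->] ->].
  by exists e0; rewrite !inE ?e0S ?eqxx.
have [|u|v|c cP] := IH (S :\ e0).
- by rewrite (leq_trans _ Sn) // [leqRHS](cardsD1 e0) e0S.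
- exact: leq_trans (sub _) (dx u).
- exact: leq_trans (sub _) (dy v).
have [a ak aP] := missing_color c (leq_trans (sub1 [pred e | x e == x e0] (eqxx _)) (dx _)).
have [b bk bP] := missing_color c (leq_trans (sub1 [pred e | y e == y e0] (eqxx _)) (dy _)).
have [||c' [c'P ax ay]] := kempe_swap (e0 := e0) ak bk cP.
- by move=> e eS xe; apply: aP; rewrite inE eS inE xe eqxx.
- by move=> e eS ye; apply: bP; rewrite inE eS inE ye eqxx.
rewrite -(setD1K e0S); eexists; exact: proper_add e0S' ak c'P ax ay.
Qed.
End Konig.

(** * The local lemma *)

Section LocalLemma.
Variables (V C : finType).
Local Notation Omega := {ffun V -> C}.

Definition depends_on (A : {set V}) (P : pred Omega) :=
  forall phi psi : Omega, {in A, phi =1 psi} -> P phi = P psi.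

(* Exchanging the restrictions to [A] of [phi] and [psi] injects
   [(P & Q) * Omega] into [P * Q]. *)
Lemma card_independent (A : {set V}) (P Q : pred Omega) :
  depends_on A P -> depends_on (~: A) Q ->
  #|[set phi | P phi && Q phi]| * #|{: Omega}| <= #|[set phi | P phi]| * #|[set phi | Q phi]|.
Proof.
move=> dP dQ.
pose mix (phi psi : Omega) : Omega := [ffun v => if v \in A then phi v else psi v].
pose g (x : Omega * Omega) := (mix x.1 x.2, mix x.2 x.1).
have gK : involutive g.
  by move=> [phi psi]; rewrite /g /=; congr pair; apply/ffunP => v; rewrite !ffunE; case: (v \in A).
rewrite -[X in _ * X]cardsT -!cardsX -(card_imset _ (inv_inj gK)).
apply/subset_leq_card/subsetP => _ /imsetP[[phi psi] /setXP[H _] ->].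
have /andP[Pphi Qphi] : P phi && Q phi by move: H; rewrite inE.
rewrite !inE /=.
rewrite (dP _ phi) ?(dQ _ phi) ?Pphi //.
  by move=> v; rewrite inE ffunE => /negbTE->.
by move=> v; rewrite ffunE => ->.
Qed.

Variables (I : finType) (A : I -> {set V}) (bad : I -> pred Omega) (m n : nat).
Hypothesis bad_dep : forall i, depends_on (A i) (bad i).
Hypothesis A_neq0 : forall i, A i = set0 -> bad i =1 xpred0.
Hypothesis C_gt0 : 0 < #|C|.
Hypothesis n_gt0 : 0 < n.
Hypothesis A_card : forall i, #|A i| <= n.
Hypothesis A_deg : forall v, #|[set i | v \in A i]| <= m.
Hypothesis bad_card : forall i, 4 * m * n * #|[set phi | bad i phi]| <= #|{: Omega}|.

(** Only events supported inside [S] count, so adding a vertex creates only events that involve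
    it. *)
Definition good (S : {set V}) : pred Omega :=
  fun phi => [forall i, (A i \subset S) ==> ~~ bad i phi].
Local Notation N S := #|[set phi | good S phi]|.

Lemma good_dep S : depends_on S (good S).
Proof.
move=> phi psi eqS; apply: eq_forallb => i; case: (boolP (A i \subset S)) => //= /subsetP AS.
by congr negb; apply: bad_dep => v /AS; exact: eqS.
Qed.

Lemma good_sub (S T : {set V}) phi : S \subset T -> good T phi -> good S phi.
Proof.
move=> ST /forallP gT; apply/forallP => i; apply/implyP => AS.
by have := gT i; rewrite (subset_trans AS ST).
Qed.

(* The bad events created by adding [v] are few, as each is independent of
   [good (S :\: A i)], which by induction has at most twice as many elements
   as [good S]. This replaces the conditional probabilities of the usual proof
   of the local lemma. *)
Lemma good_step S v : 2 * n * N S <= N S + 2 * n * N (v |: S).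
Proof.
have [k] := ubnP #|S|; elim: k => // k IH in S v *; rewrite ltnS => Sk.
have [vS|vS] := boolP (v \in S).
  by rewrite (setUidPr _) ?sub1set // leq_addl.
(* Adding the elements of [T] one at a time loses at most [N B] over [2 * n] each; the outer
   induction applies since every intermediate set is smaller than [S]. *)
have many B T : B :|: T \subset S -> 2 * n * N B <= #|T| * N B + 2 * n * N (B :|: T).
  have [l] := ubnP #|T|; elim: l => // l IHl in T *; rewrite ltnS => Tl BT.
  have [->|[w wT]] := set_0Vmem T; first by rewrite cards0 mul0n add0n setU0.
  have sub : B :|: T :\ w \subset S.
    by apply: subset_trans BT; rewrite setUS // subD1set.
  have := IHl (T :\ w); rewrite (cardsD1 w T) wT /= => /(_ _ sub).
  rewrite (leq_trans _ Tl) ?(cardsD1 w T) ?wT // => /(_ isT) H.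
  have DU : B :|: T = w |: (B :|: T :\ w).
    by rewrite setUCA setD1K.
  rewrite DU; case: (boolP (w \in B)) => wB.
    rewrite (setUidPr _) ?sub1set ?inE ?wB //; lia.
  have lt : #|B :|: T :\ w| < k.
    apply: leq_trans Sk; apply: proper_card; apply/properP; split=> //.
    by exists w; rewrite ?(subsetP BT) ?inE ?wT ?orbT // eqxx negb_or wB.
  have := IH _ w lt.
  have : N (B :|: T :\ w) <= N B.
    by apply/subset_leq_card/subsetP => phi; rewrite !inE; apply/good_sub/subsetUl.
  move: H; rewrite mulnDl mul1n.
  move: (N B) (N (B :|: T :\ w)) (N (w |: _)) #|T :\ w| => x y z u; lia.
pose J := [set i | v \in A i & A i \subset v |: S].
have half i : i \in J -> N (S :\: A i) <= 2 * N S.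
  rewrite inE => /andP[vA AS].
  have := many (S :\: A i) (S :&: A i).
  rewrite setUC setID subxx => /(_ isT).
  have leT : #|S :&: A i| <= n by apply: leq_trans (A_card i); rewrite subset_leq_card ?subsetIr.
  move: (N (S :\: A i)) (N S) #|S :&: A i| leT => x y z zn.
  have : z * x <= n * x by rewrite leq_mul2r zn orbT.
  rewrite -[x <= _](leq_pmul2l n_gt0); lia.
pose X i := [set phi | bad i phi && good (S :\: A i) phi].
have cover : N S <= N (v |: S) + \sum_(i in J) #|X i|.
  apply: leq_trans (_ : #|[set phi | good (v |: S) phi] :|: \bigcup_(i in J) X i| <= _).
    apply/subset_leq_card/subsetP => phi; rewrite !inE => gphi.
    case: (boolP (good (v |: S) phi)) => //=; rewrite negb_forall => /existsP[i].
    rewrite negb_imply negbK => /andP[AS bi]; apply/bigcupP; exists i; last first.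
      by rewrite inE bi; apply: good_sub gphi; rewrite subsetDl.
    rewrite inE AS andbT; apply: contraLR bi => vA.
    have /forallP/(_ i) := gphi; rewrite (_ : A i \subset S) //.
    apply/subsetP => w wA; have := subsetP AS w wA; rewrite !inE => /orP[/eqP wv|//].
    by rewrite -wv wA in vA.
  rewrite cardsU; apply: leq_trans (leq_subr _ _) _; rewrite leq_add2l.
  elim/big_rec2: _ => [|i x B _ H]; first by rewrite cards0.
  by rewrite cardsU; apply: leq_trans (leq_subr _ _) _; rewrite leq_add2l.
have O_gt0 : 0 < #|{: Omega}| by rewrite card_ffun expn_gt0 C_gt0.
(* Independence bounds the share of [X i] by the probability of [bad i], at most 1 over [4 * m * n],
   times that of [good (S :\: A i)], which [half] controls. *)
have Xle i : i \in J -> 4 * m * n * #|X i| <= 2 * N S.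
  move=> iJ; apply: leq_trans (half i iJ); rewrite -(leq_pmul2r O_gt0).
  have ind := @card_independent (A i) (bad i) (good (S :\: A i)) (@bad_dep i).
  apply: leq_trans (_ : 4 * m * n * (#|[set phi | bad i phi]| * N (S :\: A i)) <= _).
    rewrite -mulnA leq_mul2l ind ?orbT // => phi psi eq; apply: good_dep => w.
    by rewrite inE => /andP[wA _]; apply: eq; rewrite inE.
  by rewrite mulnA [leqLHS]mulnC leq_mul2l bad_card orbT.
have Jm : #|J| <= m.
  by apply: leq_trans (A_deg v); apply/subset_leq_card/subsetP => i; rewrite !inE => /andP[].
have sumX : 2 * n * \sum_(i in J) #|X i| <= N S.
  have [/eqP|J_gt0] := posnP #|J|.
    by rewrite cards_eq0 => /eqP->; rewrite big_set0 muln0.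
  have m0 : 0 < m by apply: leq_trans Jm.
  rewrite -(@leq_pmul2l (2 * m)) ?muln_gt0 //.
  have : \sum_(i in J) 4 * m * n * #|X i| <= \sum_(i in J) 2 * N S by apply: leq_sum.
  rewrite -big_distrr /= sum_nat_const.
  move: (\sum_(i in J) _) => x le.
  have leJ : #|J| * (2 * N S) <= m * (2 * N S) by rewrite leq_mul2r Jm orbT.
  by move: (leq_trans le leJ); move: (N S) => y; lia.
have : 2 * n * N S <= 2 * n * (N (v |: S) + \sum_(i in J) #|X i|).
  by rewrite leq_mul2l cover orbT.
rewrite mulnDr; move: sumX; set a := 2 * n * \sum_(i in J) _.
move: (2 * n * N S) (2 * n * N (v |: S)) (N S) a => *; lia.
Qed.

(** Every colouring is good for the empty set, and by [good_step] each new vertex keeps at least the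
    fraction 1 - 1/(2n) of the good colourings, so some remain for [setT]. *)
Lemma local_lemma : exists phi : Omega, forall i, ~~ bad i phi.
Proof.
have O_gt0 : 0 < #|{: Omega}| by rewrite card_ffun expn_gt0 C_gt0.
suff : 0 < N setT.
  case/card_gt0P => phi; rewrite inE => /forallP gphi; exists phi => i.
  by have := gphi i; rewrite subsetT.
have [k] := ubnP #|[set: V]|; elim: k (setT) => // k IH S; rewrite ltnS => Sk.
have [->|[v vS]] := set_0Vmem S.
  rewrite (_ : [set phi | good set0 phi] = setT) ?cardsT //.
  apply/setP => phi; rewrite !inE; apply/forallP => i; apply/implyP.
  by rewrite subset0 => /eqP/A_neq0->.
have := good_step (S :\ v) v; rewrite setD1K //.
have := IH (S :\ v) (leq_trans _ Sk); rewrite [in X in X -> _](cardsD1 v S) vS => /(_ (leqnn _)).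
nia.
Qed.
End LocalLemma.

(** * Arc colourings from vertex colourings *)

(** Cut an enumeration of [A] into consecutive blocks of length [l]. *)
Lemma balanced_split (T : finType) (A : {set T}) k l : #|A| <= k * l ->
  exists h : T -> nat, {in A, forall v, h v < k} /\
    forall q, #|[set v in A | h v == q]| <= l.
Proof.
have [->|l_gt0] := posnP l => Ak.
  exists (fun=> 0); move: Ak; rewrite muln0 leqn0 cards_eq0 => /eqP->.
  split=> [v|q]; first by rewrite inE.
  by rewrite leqn0 cards_eq0; apply/eqP/setP => v; rewrite !inE.
exists (fun v => index v (enum A) %/ l); split=> [v vA|q].
  by rewrite ltn_divLR //; apply: leq_trans Ak; rewrite cardE index_mem mem_enum.
pose g v : 'I_l := Ordinal (ltn_pmod (index v (enum A)) l_gt0).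
rewrite -[leqRHS]card_ord -(@card_in_imset _ _ g) ?max_card //.
move=> u v; rewrite !inE => /andP[uA /eqP uq] /andP[vA /eqP vq] /(congr1 val)/= uv.
have : index u (enum A) = index v (enum A).
  by rewrite (divn_eq (index u _) l) (divn_eq (index v _) l) uq vq uv.
move=> idx; rewrite -(nth_index u (s := enum A) (x := u)) ?mem_enum // idx nth_index ?mem_enum //.
Qed.

Section RelColoring.
Variables (V : finType) (f : V -> nat).
Implicit Types e : rel V.

(** [arborically_colorable] for any relation, so that parts of the arc set can be coloured
    separately with disjoint palettes. *)
Definition rel_colorable e k := exists c : V * V -> nat,
  (forall u v, e u v -> c (u, v) < k) /\
  (forall i, i < k -> degree_branching [rel u v | e u v && (c (u, v) == i)] f).

Lemma degree_branching_sub e1 e2 :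
  subrel e1 e2 -> degree_branching e2 f -> degree_branching e1 f.
Proof.
move=> sub [[ind fo] outd]; split; first split.
- move=> v; apply: leq_trans (ind v); apply/subset_leq_card/subsetP => u.
  by rewrite !inE; apply: sub.
- move=> p q; apply: contra (fo p q) => /and4P[p0 up uq cyc]; apply/and4P; split=> //.
  move: cyc; rewrite !all2E => /andP[-> /= cyc]; apply: sub_all cyc => -[a xy] /=.
  by case/andP=> /sub-> ->.
- move=> v; apply: leq_trans (outd v); apply/subset_leq_card/subsetP => u.
  by rewrite !inE; apply: sub.
Qed.

Lemma rel_colorableU e e1 e2 k1 k2 :
  (forall u v, e u v -> e1 u v || e2 u v) ->
  rel_colorable e1 k1 -> rel_colorable e2 k2 -> rel_colorable e (k1 + k2).
Proof.
move=> eU [c1 [ck1 cb1]] [c2 [ck2 cb2]].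
exists (fun a => if e1 a.1 a.2 then c1 a else k1 + c2 a); split=> [u v /eU /=|i ik].
  case: ifP => /= e1uv e2uv; first by apply: leq_trans (leq_addr _ _); apply: ck1.
  by rewrite ltn_add2l ck2.
have [ik1|ik1] := ltnP i k1.
  apply: degree_branching_sub (cb1 i ik1) => u v /= /andP[_].
  by case: (e1 u v) => [-> //|/eqP Di]; rewrite -Di ltnNge leq_addr in ik1.
apply: degree_branching_sub (cb2 (i - k1) _); last by rewrite ltn_subLR.
move=> u v /= /andP[/eU]; case: ifP => /= [euv _ /eqP Di|_ -> /eqP<-].
  by have := ck1 u v euv; rewrite Di ltnNge ik1.
by rewrite addKn eqxx.
Qed.

Lemma rel_colorable_bigU e (lab : V * V -> nat) n k :
  (forall s, s < n -> rel_colorable [rel u v | e u v && (lab (u, v) == s)] k) ->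
  rel_colorable [rel u v | e u v && (lab (u, v) < n)] (n * k).
Proof.
elim: n => [_|n IH H].
  by exists (fun=> 0); split=> // u v /=; rewrite andbF.
rewrite mulSnr; apply: rel_colorableU (IH _) (H n _) => // [u v /=|s sn].
  by rewrite ltnS leq_eqVlt; case: (e u v) => //=; rewrite orbC.
by apply: H; rewrite ltnS ltnW.
Qed.

(** An arc meets at most [2 * (a + b)] arcs, itself included, so greedy colouring yields matchings,
    and these are degree-[f] branchings because [f v - 1] is positive. *)
Lemma greedy_colorable e a b : irreflexive e -> (forall v, 2 <= f v) ->
  (forall v, indeg e v <= a) -> (forall v, outdeg e v <= b) ->
  rel_colorable e (2 * (a + b)).+1.
Proof.
move=> irr f2 ina outb.
pose meet (x y : V * V) := [|| x.1 == y.1, x.1 == y.2, x.2 == y.1 | x.2 == y.2].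
pose r : rel (V * V) := [rel x y | [&& e x.1 x.2, e y.1 y.2 & meet x y]].
have symr : symmetric r.
  move=> x y; rewrite /r /= /meet (eq_sym y.1) (eq_sym y.2) (eq_sym y.1 x.2) (eq_sym y.2 x.2).
  by case: (e _ _); case: (e _ _) => //=; case: (_ == _); case: (_ == _); rewrite ?orbT.
have degr x : #|[set y | r x y]| < (2 * (a + b)).+1.
  pose inc v := [set (u, v) | u in [set u | e u v]] :|: [set (v, w) | w in [set w | e v w]].
  have inc_card v : #|inc v| <= a + b.
    rewrite cardsU; apply: leq_trans (leq_subr _ _) _.
    by apply: leq_add; apply: leq_trans (leq_imset_card _ _) _; [apply: ina|apply: outb].
  rewrite ltnS; apply: leq_trans (_ : #|inc x.1 :|: inc x.2| <= _); last first.
    by rewrite cardsU mul2n -addnn; apply: leq_trans (leq_subr _ _) _; apply: leq_add.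
  apply/subset_leq_card/subsetP => -[u w]; rewrite /r /= !inE /meet /=.
  have I1 : e u w -> (u, w) \in [set (u, w) | u in [set u | e u w]].
    by move=> euw; apply: imset_f; rewrite inE.
  have I2 : e u w -> (u, w) \in [set (u, w) | w in [set w | e u w]].
    by move=> euw; apply: imset_f; rewrite inE.
  by case/and3P=> _ euw /or4P[]/eqP->; rewrite ?(I1 euw) ?(I2 euw) ?orbT.
have [c [ck cP]] := greedy_coloring symr degr.
have neq x y i : e x.1 x.2 -> e y.1 y.2 -> c x == i -> c y == i -> meet x y -> x = y.
  move=> ex ey /eqP cx /eqP cy mxy; apply/eqP; apply: contraT => xy.
  by have := cP x y xy; rewrite /r /= ex ey mxy cx cy eqxx => /(_ isT).
exists c; split=> // i _.
have in1 v : indeg [rel u v | e u v && (c (u, v) == i)] v <= 1.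
  apply/card_le1_eqP => u u'; rewrite !inE /= => /andP[eu cu] /andP[eu' cu'].
  suff /(congr1 fst) : (u', v) = (u, v) by [].
  by apply: (neq _ _ i) => //; rewrite /meet /= ?eqxx ?orbT.
split; first split=> //.
  (* In a matching no arc follows another, so a constant [g] is vacuously increasing. *)
  apply: (increasing_forest (g := fun=> 0)) => // u v w /andP[eu cu] /andP[ew cw].
  have uv_vw : meet (u, v) (v, w) by rewrite /meet /= eqxx ?orbT.
  by have /(congr1 fst)/= uv := neq (u, v) (v, w) i eu ew cu cw uv_vw; rewrite uv irr in eu.
move=> v; apply: (@leq_trans 1); last by rewrite subn_gt0.
apply/card_le1_eqP => u u'; rewrite !inE /= => /andP[eu cu] /andP[eu' cu'].
suff /(congr1 snd) : (v, u') = (v, u) by [].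
by apply: (neq _ _ i) => //; rewrite /meet /= ?eqxx ?orbT.
Qed.

(** Split each tail [u] into [f u - 1] copies with at most [k] arcs each. The bipartite graph
    between copies and heads has maximum degree at most [k], and each of its colours occurs at most
    once per copy. *)
Lemma konig_degree_coloring e k :
  (forall v, indeg e v <= k) -> (forall v, outdeg e v <= (f v - 1) * k) ->
  exists c : V * V -> nat, (forall u v, e u v -> c (u, v) < k) /\
    forall i, (forall v, indeg [rel u v | e u v && (c (u, v) == i)] v <= 1) /\
              (forall v, outdeg [rel u v | e u v && (c (u, v) == i)] v <= f v - 1).
Proof.
move=> ind outd.
have /fin_all_exists[h hP] u := balanced_split (outd u).
pose S := [set a : V * V | e a.1 a.2].
have injr (u : V) : injective (fun w : V => (u, w)) by move=> ? ? [].
have injl (w : V) : injective (fun u : V => (u, w)) by move=> ? ? [].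
have [[u q]|v|c [ck cx cy]] :=
  @konig_coloring _ _ _ (fun a : V * V => (a.1, h a.1 a.2)) snd k S.
- have [_ /(_ q)] := hP u; apply: leq_trans.
  rewrite -(card_imset _ (injr u)).
  apply/subset_leq_card/subsetP => -[u' v]; rewrite !inE /= xpair_eqE.
  by case/andP=> ev /andP[/eqP Du hv]; rewrite Du in ev hv *; apply: imset_f; rewrite !inE ev.
- apply: leq_trans (ind v).
  rewrite /indeg -(card_imset _ (injl v)).
  apply/subset_leq_card/subsetP => -[u w]; rewrite !inE /=.
  by case/andP=> ev /eqP Dw; rewrite Dw in ev *; apply: imset_f; rewrite inE.
exists c; split=> [u v ev|i]; first by apply: ck; rewrite inE.
split=> v.
  apply/card_le1_eqP => u u'; rewrite !inE /= => /andP[eu /eqP cu] /andP[eu' /eqP cu'].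
  suff /(congr1 fst) : (u', v) = (u, v) by [].
  by apply: cy; rewrite ?inE ?cu ?cu'.
have [hk _] := hP v.
case Dk: (f v - 1) => [|n].
  rewrite leqn0 /outdeg cards_eq0; apply/eqP/setP => w; rewrite !inE /=.
  by apply/negP => /andP[ew _]; have := hk w; rewrite inE ew Dk => /(_ isT).
rewrite /outdeg -[leqRHS]card_ord -(@card_in_imset _ _ (fun w => inord (h v w) : 'I_n.+1)) ?max_card //.
move=> w w'; rewrite !inE /= => /andP[ew /eqP cw] /andP[ew' /eqP cw'] /(congr1 val).
rewrite /= !inordK -?Dk ?hk ?inE // => hw.
suff /(congr1 snd) : (v, w) = (v, w') by [].
by apply: cx; rewrite ?inE ?cw ?cw' //= hw.
Qed.

Lemma partition_colorable e (phi : V -> nat) m k t :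
    irreflexive e -> (forall v, 2 <= f v <= t) -> (forall v, phi v < m.*2) ->
    (forall v j, #|[set u | e u v & phi u == j]| <= k) ->
    (forall v j, #|[set w | e v w & phi w == j]| <= (f v - 1) * k) ->
  rel_colorable e (m.*2 * k + (2 * (k + t * k)).+1).
Proof.
move=> irr ft phim ink outk.
(* The label [m.*2] lies outside the range of the paths and marks the arcs between vertices of equal
   colour. *)
pose lab (a : V * V) :=
  if phi a.1 == phi a.2 then m.*2 else zigzag m (phi a.1) (phi a.2).
apply: (@rel_colorableU _ [rel u v | e u v && (lab (u, v) < m.*2)]
                         [rel u v | e u v && (phi u == phi v)]).
- move=> u v euv; rewrite /= euv /lab /=; case: eqP => [_|/eqP uv]; first by rewrite orbT.
  by rewrite zigzag_lt.
- apply: rel_colorable_bigU => s sm.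
  set es := [rel u v | _].
  have esP u v : es u v -> [/\ e u v, phi u != phi v & zigzag m (phi u) (phi v) = s].
    case/andP=> euv; rewrite /lab /=; case: (phi u =P phi v) => [_ /eqP E|/eqP ? /eqP //].
    by rewrite -E ltnn in sm.
  have ind v : indeg es v <= k.
    have [E|[u0]] := set_0Vmem [set u | es u v]; first by rewrite /indeg E cards0.
    rewrite inE => /esP[_ n0 z0]; apply: leq_trans (ink v (phi u0)).
    apply/subset_leq_card/subsetP => u; rewrite !inE => /esP[-> n1 z1] /=.
    by apply/eqP; apply: (zigzag_injl (phim u) (phim u0) (phim v) n1 n0); rewrite z0.
  have outd v : outdeg es v <= (f v - 1) * k.
    have [E|[u0]] := set_0Vmem [set u | es v u]; first by rewrite /outdeg E cards0.
    rewrite inE => /esP[_ n0 z0]; apply: leq_trans (outk v (phi u0)).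
    apply/subset_leq_card/subsetP => u; rewrite !inE => /esP[-> n1 z1] /=.
    by apply/eqP; apply: (zigzag_injr (phim v) (phim u) (phim u0) n1 n0); rewrite z0.
  have [c [ck cP]] := konig_degree_coloring ind outd.
  exists c; split=> // i _; have [in1 outf] := cP i; split=> //; split=> //.
  apply: (increasing_forest (g := fun a => zigzag_rank m (phi a.1) (phi a.2))) => //.
  move=> u v w /andP[/esP[_ n1 z1] _] /andP[/esP[_ n2 z2] _] /=.
  by apply: zigzag_rank_lt => //; rewrite z1.
- apply: greedy_colorable => [u|v|v|v] /=; first by rewrite irr.
  + by case/andP: (ft v).
  + by apply: leq_trans (ink v (phi v)); apply/subset_leq_card/subsetP => u; rewrite !inE.
  + apply: leq_trans (_ : (f v - 1) * k <= _).
      apply: leq_trans (outk v (phi v)); apply/subset_leq_card/subsetP => u.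
      by rewrite !inE /= eq_sym.
    rewrite leq_mul2r; case/andP: (ft v) => _ fv.
    by rewrite (leq_trans (leq_subr _ _) fv) orbT.
Qed.
End RelColoring.

(** * Random colourings *)

Import Order.TTheory GRing.Theory Num.Theory.
Local Open Scope ring_scope.

(* Markov's inequality for [w ^ X], with [X] the number of elements of [A]
   that [phi] maps to [j]. *)
Lemma card_crowded (R : realFieldType) (V : finType) (p : nat)
    (A : {set V}) (j : 'I_p) (n : nat) (w : R) :
  1 <= w ->
  #|[set phi : {ffun V -> 'I_p} | (n <= #|[set v in A | phi v == j]|)%N]|%:R * w ^+ n <=
    #|{: {ffun V -> 'I_p}}|%:R * (1 + (w - 1) / p%:R) ^+ #|A| :> R.
Proof.
move=> w_ge1; have w_ge0 : 0 <= w by apply: le_trans w_ge1.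
have p_gt0 : (0 < p)%N by apply: leq_trans (ltn_ord j).
have p_neq0 : p%:R != 0 :> R by rewrite pnatr_eq0 -lt0n.
pose F v (i : 'I_p) : R := if (v \in A) && (i == j) then w else 1.
have prodF (phi : {ffun V -> 'I_p}) : \prod_v F v (phi v) = w ^+ #|[set v in A | phi v == j]|.
  rewrite /F -big_mkcond /= prodr_const; congr (_ ^+ _).
  by apply: eq_card => v; rewrite !inE.
have sumF v : \sum_i F v i = p%:R * (if v \in A then 1 + (w - 1) / p%:R else 1).
  rewrite /F; case: (v \in A) => /=; last by rewrite sumr_const card_ord mulr1.
  rewrite (bigD1 j) //= eqxx (eq_bigr (fun=> 1)) => [|i /negbTE-> //].
  rewrite sumr_const cardC1 card_ord mulrDr mulr1 mulrCA divff // mulr1.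
  by rewrite -subn1 natrB //; ring.
(* The total weight of all colourings factors into the one-vertex sums [sumF]. *)
apply: (@le_trans _ _ (\sum_(phi : {ffun V -> 'I_p}) \prod_v F v (phi v))); last first.
  rewrite -bigA_distr_bigA; under eq_bigr do rewrite sumF.
  rewrite big_split /= prodr_const -big_mkcond /= prodr_const card_ffun card_ord natrX.
  by rewrite le_eqVlt; apply/orP; left; apply/eqP.
rewrite mulr_natl -sumr_const big_mkcond /=; apply: ler_sum => phi _.
rewrite prodF inE; case: ifP => [|_]; last by rewrite exprn_ge0.
exact: ler_weXn2l.
Qed.

(** Since exp(-h) >= 1 - h, it suffices that (1 - h)(1 + h + 2h^2) = 1 + h^2 (1 - 2h) is at least
    1. *)
Lemma expR_le_quadratic (R : realType) (h : R) : 0 <= h <= 1 / 2 -> expR h - 1 <= h + 2 * h ^+ 2.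
Proof.
move=> /andP[h0 h2].
have e : expR h * (1 - h) <= 1.
  by rewrite -[leRHS](expRxMexpNx_1 h) ler_wpM2l ?expR_ge0 // expR_ge1Dx.
have h1 : 0 < 1 - h by lra.
rewrite lerBlDl -(ler_pM2r h1); apply: le_trans e _.
nra.
Qed.

(* By [wk] each of the at most [t * d * p] events at a vertex has probability
   at most [d ^- 4]. *)
Lemma uncrowded_coloring (R : realFieldType) (V : finType) (e : rel V) (f : V -> nat)
    (t d p k : nat) (w : R) :
    (forall v, 2 <= f v <= t)%N ->
    (forall v, indeg e v <= d)%N -> (forall v, outdeg e v <= (f v - 1) * d)%N ->
    (0 < t)%N -> (0 < d)%N -> (0 < p)%N -> (4 * t ^ 2 * p <= d ^ 2)%N ->
    1 <= w -> d%:R ^+ 4 * (1 + (w - 1) / p%:R) ^+ d <= w ^+ k ->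
  exists phi : V -> 'I_p,
    (forall v j, #|[set u | e u v & phi u == j]| <= k)%N /\
    (forall v j, #|[set u | e v u & phi u == j]| <= (f v - 1) * k)%N.
Proof.
move=> ft ind outd t_gt0 d_gt0 p_gt0 tpd w_ge1 wk.
pose I := (V * bool * 'I_p)%type.
pose A (i : I) := if i.1.2 then [set u | e i.1.1 u] else [set u | e u i.1.1].
pose b (i : I) := (if i.1.2 then f i.1.1 - 1 else 1)%N.
pose bad (i : I) (phi : {ffun V -> 'I_p}) := (b i * k < #|[set u in A i | phi u == i.2]|)%N.
have b_gt0 i : (0 < b i)%N.
  by rewrite /b; case: ifP => // _; have /andP[] := ft i.1.1; lia.
have b_lt i : (b i <= t)%N.
  by rewrite /b; case: ifP => // _; have /andP[] := ft i.1.1; lia.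
have A_card i : (#|A i| <= b i * d)%N.
  by rewrite /A /b; case: ifP => _; rewrite ?mul1n; [apply: outd | apply: ind].
have y_ge1 : 1 <= 1 + (w - 1) / p%:R by rewrite lerDl divr_ge0 ?subr_ge0.
set y := 1 + _ in wk y_ge1.
have bad_card i : (d ^ 4 * #|[set phi | bad i phi]| <= #|{: {ffun V -> 'I_p}}|)%N.
  have tail := card_crowded (A i) i.2 (b i * k) w_ge1; rewrite -/y in tail.
  have leN : (#|[set phi | bad i phi]| <=
      #|[set phi : {ffun V -> 'I_p} | (b i * k <= #|[set v in A i | phi v == i.2]|)%N]|)%N.
    by apply/subset_leq_card/subsetP => phi; rewrite !inE; apply: ltnW.
  rewrite -(ler_nat R) natrM natrX.
  have yp : 0 < y ^+ (b i * d) by rewrite exprn_gt0 // (lt_le_trans ltr01).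
  rewrite -(ler_pM2r yp).
  apply: (@le_trans _ _ (#|{: {ffun V -> 'I_p}}|%:R * y ^+ #|A i|)); last first.
    by rewrite ler_wpM2l ?ler_weXn2l.
  apply: le_trans tail.
  apply: (@le_trans _ _ (#|[set phi | bad i phi]|%:R * w ^+ (b i * k))); last first.
    by rewrite ler_wpM2r ?exprn_ge0 ?ler_nat // (le_trans ler01).
  rewrite mulrAC mulrC ler_wpM2l //.
  (* Raise [wk] to the power [b i]; as [b i >= 1], this keeps at least one factor [d ^ 4]. *)
  apply: (@le_trans _ _ ((d%:R ^+ 4 * y ^+ d) ^+ b i)); last first.
    by rewrite mulnC exprM lerXn2r // nnegrE ?mulr_ge0 ?exprn_ge0 // (le_trans ler01).
  rewrite exprMn -[in leRHS]exprM -[in leRHS]exprM [(d * _)%N]mulnC.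
  rewrite ler_wpM2r ?exprn_ge0 ?(le_trans ler01) //.
  by rewrite ler_weXn2l ?ler1n // leq_pmulr.
(* An event reads at most [t * d] vertices, and a vertex lies in at most [t * d * p] events. The
   condition becomes [4 * t ^ 2 * p * d ^ 2 <= d ^ 4]. *)
have [i|i|||i|x|i|phi phiP] := @local_lemma V 'I_p I A bad (t * d * p) (t * d).
- move=> phi psi eq_A; rewrite /bad; congr (_ < _)%N; apply: eq_card => u.
  by rewrite !inE; case uA: (u \in A i) => //=; rewrite eq_A.
- move=> Ai phi; rewrite /bad Ai (_ : [set u in set0 | _] = set0) ?cards0 //.
  by apply/setP => u; rewrite !inE.
- by rewrite card_ord.
- by rewrite muln_gt0 t_gt0.
- by apply: leq_trans (A_card i) _; rewrite leq_mul2r b_lt orbT.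
- pose B := setX (setX [set v | e v x] [set true]) [set: 'I_p]
    :|: setX (setX [set v | e x v] [set false]) [set: 'I_p].
  apply: (@leq_trans #|B|).
    apply/subset_leq_card/subsetP => -[[v []] j]; rewrite inE /A /= !inE /= => ->;
    by rewrite ?orbT.
  rewrite cardsU; apply: leq_trans (leq_subr _ _) _.
  rewrite !cardsX !cards1 cardsT card_ord !muln1 -mulnDl leq_mul2r; apply/orP; right.
  apply: (@leq_trans (d + (f x - 1) * d)); first by rewrite leq_add //; [apply: ind|apply: outd].
  rewrite -mulSn leq_mul2r; apply/orP; right; have := ft x; lia.
- apply: leq_trans (bad_card i); rewrite leq_mul2r; apply/orP; right.
  apply: (@leq_trans (4 * t ^ 2 * p * d ^ 2)%N); first lia.
  by rewrite (_ : d ^ 4 = d ^ 2 * d ^ 2)%N ?leq_mul2r ?tpd ?orbT // -expnD.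
exists phi; split=> v j.
  have := phiP (v, false, j); rewrite /bad -leqNgt /b /A /= mul1n; apply: leq_trans.
  by apply/subset_leq_card/subsetP => u; rewrite !inE.
have := phiP (v, true, j); rewrite /bad -leqNgt /b /A /=; apply: leq_trans.
by apply/subset_leq_card/subsetP => u; rewrite !inE.
Qed.

(** * Choice of the parameters *)

Lemma powR_invnK (R : realType) (a b : R) (n : nat) : 0 <= a -> (0 < n)%N -> b = n%:R^-1 ->
  (a `^ b) ^+ n = a.
Proof.
move=> a0 n0 ->; rewrite -powR_mulrn ?powR_ge0 // -powRrM mulVf ?powRr1 //.
by rewrite pnatr_eq0 -lt0n.
Qed.

(* With [x = d^(1/4)] and [l = sqrt (ln d)], the witnesses are
   [m = floor (x^2)], [w = exp (l / x)] and [k] just above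
   [d / (2 * m) + 6 * l * x]. *)
Lemma coloring_parameters (R : realType) (t d : nat) :
    (4 ^ 8 <= d)%N -> (8 * t ^ 2 <= d)%N ->
  exists (m k : nat) (w : R),
    [/\ (0 < m)%N, (4 * t ^ 2 * m.*2 <= d ^ 2)%N, 1 <= w,
        d%:R ^+ 4 * (1 + (w - 1) / m.*2%:R) ^+ d <= w ^+ k &
        (m.*2 * k + (2 * (k + t * k)).+1)%:R <=
          d%:R + (16 * t + 31)%:R * d%:R `^ (3 / 4) * (ln d%:R) `^ (1 / 2) :> R].
Proof.
have assoc (a b : nat) : (4 * a * (b * 2) = 8 * a * b)%N by lia.
move=> d_big td; set D : R := d%:R.
have D_big : 4 ^+ 8 <= D by rewrite /D -natrX ler_nat; exact: d_big.
clear d_big.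
have D_gt0 : 0 < D by lra.
(* The eighth root gives ln D = 8 ln y <= 8y, and with y >= 4 this yields [l <= x / 2], that is
   [h <= 1 / 2]. *)
pose y := D `^ 8^-1; pose l := (ln D) `^ 2^-1.
have y_ge0 : 0 <= y by apply: powR_ge0.
have y8 : y ^+ 8 = D by rewrite powR_invnK // ltW.
have y_gt0 : 0 < y by rewrite powR_gt0.
have y_ge4 : 4 <= y.
  rewrite leNgt; apply/negP => y4; have : y ^+ 8 < 4 ^+ 8 by rewrite ltrXn2r // nnegrE.
  rewrite y8; lra.
have lnD : 1 <= ln D.
  rewrite -[leLHS]expRK ler_ln ?posrE ?expR_gt0 //.
  have : expR (1 / 2) - 1 <= 1 / 2 + 2 * (1 / 2) ^+ 2 :> R by apply: expR_le_quadratic; lra.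
  have -> : expR 1 = expR (1 / 2) * expR (1 / 2) :> R by rewrite -expRD; congr expR; lra.
  have := expR_gt0 (1 / 2 : R); move: (expR _) => u; nra.
have l2 : l ^+ 2 = ln D by rewrite powR_invnK // ln_ge0 //; lra.
have l_ge0 : 0 <= l by apply: powR_ge0.
have l_ge1 : 1 <= l by nra.
have lny : l ^+ 2 <= 8 * y.
  rewrite l2 -y8 lnXn // -[leLHS]mulr_natl ler_wpM2l //; apply/ltW/ln_sublinear; lra.
have D34 : D `^ (3 / 4) = y ^+ 6.
  by rewrite -powR_mulrn // -powRrM; congr (_ `^ _); lra.
rewrite D34 -[ln D `^ _]/(ln D `^ (1 / 2)) (_ : 1 / 2 = 2^-1) ?mul1r // -/l.
pose x := y ^+ 2.
have x_ge : 4 * y <= x by rewrite /x; nra.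
have Dx : D = x ^+ 4 by rewrite -y8 /x -exprM.
have x_gt0 : 0 < x by lra.
have lx : l <= x / 2.
  have : l ^+ 2 <= (x / 2) ^+ 2 by nra.
  by rewrite ler_pXn2r // nnegrE; lra.
rewrite (_ : y ^+ 6 = x ^+ 3); last by rewrite /x -exprM.
have x2_ge0 : 0 <= x ^+ 2 by rewrite exprn_ge0 // ltW.
pose m := Num.truncn (x ^+ 2); pose p : R := m.*2%:R.
have /andP[m_le m_gt] := truncn_itv x2_ge0.
rewrite -/m in m_le m_gt.
have pE : p = 2 * m%:R by rewrite /p -muln2 natrM mulrC.
have m1 : (m.+1)%:R = m%:R + 1 :> R by rewrite -natr1.
have x16 : 16 <= x by lra.
have p_ge : x ^+ 2 <= p by rewrite pE; nra.
have p_le : p <= 2 * x ^+ 2 by rewrite pE; nra.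
have p_gt0 : 0 < p by nra.
pose h := l / x; pose mu := D / p.
have hx : h * x = l by rewrite /h divfK // gt_eqF.
have mup : mu * p = D by rewrite /mu divfK // gt_eqF.
have h_ge0 : 0 <= h by rewrite divr_ge0 // ltW.
have h_le : h <= 1 / 2 by rewrite /h ler_pdivrMr //; lra.
have mu_gt0 : 0 < mu by rewrite divr_gt0.
have mu_le : mu <= x ^+ 2.
  rewrite /mu ler_pdivrMr // Dx (_ : x ^+ 4 = x ^+ 2 * x ^+ 2); last by ring.
  by rewrite ler_wpM2l.
pose z := mu + 6 * l * x.
have z_ge0 : 0 <= z by rewrite /z; nra.
pose k := (Num.truncn z).+1.
have /andP[k_le k_gt] := truncn_itv z_ge0.
rewrite -/k in k_gt.
have k_le' : k%:R <= z + 1 by rewrite /k -natr1 lerD2r.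
exists m, k, (expR h); split.
- by rewrite -(ltr_nat R); rewrite pE in p_gt0; lra.
- have mD : m%:R <= D by rewrite Dx; nra.
  have {}mD : (m <= d)%N by move: mD; rewrite /D ler_nat.
  by rewrite -muln2 assoc -[(d ^ 2)%N]mulnn leq_mul.
- by rewrite -[leLHS]expR0 ler_expR.
- rewrite -/p -/D.
  have e1 : (1 + (expR h - 1) / p) ^+ d <= expR ((h + 2 * h ^+ 2) * mu).
    apply: (@le_trans _ _ (expR ((expR h - 1) / p) ^+ d)).
      rewrite lerXn2r ?nnegrE ?expR_ge0 ?expR_ge1Dx // addr_ge0 // divr_ge0 ?(ltW p_gt0) //.
      by rewrite subr_ge0 -[leLHS]expR0 ler_expR.
    rewrite -expRM_natr ler_expR -/D mulrAC -mulrA ler_wpM2r ?(ltW mu_gt0) //.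
    by apply: expR_le_quadratic; rewrite h_ge0.
  have -> : D ^+ 4 = expR (4 * l ^+ 2).
    by rewrite l2 mulrC expRM_natr lnK.
  apply: (@le_trans _ _ (expR (4 * l ^+ 2 + (h + 2 * h ^+ 2) * mu))).
    by rewrite expRD ler_wpM2l ?expR_ge0.
  rewrite -expRM_natr ler_expR.
  (* The exponent needs 4 l^2 for [D ^+ 4] and 2 l^2 for the quadratic term, besides [h * mu]. This
     is the 6 in [z]. *)
  have h2 : h ^+ 2 * mu <= l ^+ 2.
    by rewrite -hx [leRHS]exprMn ler_wpM2l // exprn_ge0.
  have : h * z <= h * k%:R by rewrite ler_wpM2l // ltW.
  rewrite /z mulrDr (_ : h * (6 * l * x) = 6 * l ^+ 2); last by rewrite -hx; ring.
  lra.
- have -> : (m.*2 * k + (2 * (k + t * k)).+1)%:R = p * k%:R + 2 * (1 + t%:R) * k%:R + 1 :> R.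
    by rewrite natrD -natr1 !natrM natrD natrM /p; ring.
  have -> : (16 * t + 31)%:R = 16 * t%:R + 31 :> R by rewrite natrD natrM.
  have t_ge0 : 0 <= t%:R :> R by [].
  have x3 : x ^+ 2 <= x ^+ 3 by rewrite ler_eXn2l //; lra.
  have lx3 : x ^+ 3 <= x ^+ 3 * l by rewrite ler_peMr // exprn_ge0 // ltW.
  have lxx : l * x <= x ^+ 3 * l by rewrite mulrC ler_wpM2r // -[leLHS]expr1 ler_eXn2l //; lra.
  have one3 : 1 <= x ^+ 3 by rewrite exprn_ege1 //; lra.
  have kb : k%:R <= 8 * (x ^+ 3 * l) by rewrite /z in k_le'; lra.
  have pk : p * k%:R <= D + 14 * (x ^+ 3 * l).
    apply: (@le_trans _ _ (p * (z + 1))); first by rewrite ler_wpM2l // ltW.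
    rewrite /z !mulrDr mulr1 [p * mu]mulrC mup.
    have : p * (6 * l * x) <= 2 * x ^+ 2 * (6 * l * x) by rewrite ler_wpM2r //; nra.
    rewrite (_ : 2 * x ^+ 2 * (6 * l * x) = 12 * (x ^+ 3 * l)); last by ring.
    lra.
  (* The error terms add up to 14 + 16(1 + t) + 1 = 16t + 31 times [x ^+ 3 * l]. *)
  have tk : (1 + t%:R) * k%:R <= (1 + t%:R) * (8 * (x ^+ 3 * l)) by rewrite ler_wpM2l //; lra.
  rewrite -[_ * x ^+ 3 * l]mulrA; lra.
Qed.

(** * The bound on the directed arboricity *)

Section DegreeParameter.
Variables (D : digraph) (f : D -> nat).
Hypothesis f_ge2 : forall v : D, (2 <= f v)%N.

Lemma arboricity_le k : rel_colorable f (@Defs.arc D) k -> (directed_arboricity f_ge2 <= k)%N.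
Proof.
by rewrite /directed_arboricity; case: ex_minnP => n _ min col; apply: min; apply/asboolP.
Qed.

Lemma indeg_le v : (indeg (@Defs.arc D) v <= degree_parameter f)%N.
Proof. by apply: leq_trans (leq_maxl _ _); apply: leq_bigmax. Qed.

Lemma outdeg_le v : (outdeg (@Defs.arc D) v <= (f v - 1) * degree_parameter f)%N.
Proof.
rewrite mulnC -ceil_div_leq ?subn_gt0 ?f_ge2 //; apply: leq_trans (leq_maxr _ _).
exact: (@leq_bigmax _ (fun v => ceil_div (outdeg (@Defs.arc D) v) (f v - 1))).
Qed.

Lemma arboricity0 : degree_parameter f = 0%N -> directed_arboricity f_ge2 = 0%N.
Proof.
move=> d0; apply/eqP; rewrite -leqn0; apply: arboricity_le.
exists (fun=> 0%N); split=> // u v uv; have := indeg_le v.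
rewrite d0 leqn0 cards_eq0 => /eqP/setP/(_ u).
by rewrite !inE uv.
Qed.
End DegreeParameter.

(* The hypothesis [d != 1] removes the only value of d at which the inequality fails:
   there log d = 0 and the bound is 1, but a directed 3-cycle with f = 2
   has d = 1 and needs two colours. *)
Theorem theorem19 (R : realType) (t : nat) (ht : (2 <= t)%N) :
  exists2 c : R, 0 < c &
    forall (D : digraph) (f : D -> nat) (f_ge2 : forall v : D, (2 <= f v)%N)
           (f_le_t : forall v : D, (f v <= t)%N),
      let d := degree_parameter f in
      d != 1%N ->
      (directed_arboricity f_ge2)%:R <=
        d%:R + c * d%:R `^ (3 / 4) * (ln d%:R) `^ (1 / 2) :> R.
Proof.
have [d0 d0P] : exists d0, forall d, (d0 <= d)%N -> (4 ^ 8 <= d)%N /\ (8 * t ^ 2 <= d)%N.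
  by exists (maxn (4 ^ 8) (8 * t ^ 2)) => d; rewrite geq_max => /andP.
(* For 2 <= d < [d0] the greedy bound is at most [small]; since then d^(3/4) >= 1 and the
   logarithmic factor is at least [l2], the summand [small / l2] of the constant covers it. *)
pose small : R := (2 * (d0 + t * d0)).+1%:R.
pose l2 : R := ln 2 `^ (1 / 2).
have l2_gt0 : 0 < l2 by rewrite powR_gt0 // ln_gt0 // ltr1n.
pose c1 : R := (16 * t + 31)%:R.
have small_ge0 : 0 <= small / l2 by rewrite divr_ge0 // ltW.
have c1_gt0 : 0 < c1 by rewrite ltr0n addn_gt0 orbT.
exists (c1 + small / l2) => [|D f f_ge2 f_le_t d d_neq1]; first by rewrite ltr_wpDr.
have t_gt0 : (0 < t)%N by apply: leq_trans ht.
have ft v : (2 <= f v <= t)%N by rewrite f_ge2 f_le_t.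
have ind : forall v, (indeg (@Defs.arc D) v <= d)%N by apply: indeg_le.
have outd : forall v, (outdeg (@Defs.arc D) v <= (f v - 1) * d)%N by apply: outdeg_le.
have [d_eq0|d_gt0] := posnP d.
  by rewrite arboricity0 // addr_ge0 // !mulr_ge0 ?powR_ge0 // addr_ge0 // ltW.
have d_ge2 : (2 <= d)%N by rewrite ltn_neqAle eq_sym d_neq1.
set E := d%:R `^ (3 / 4); set L := ln d%:R `^ (1 / 2).
have E_ge1 : 1 <= E.
  rewrite -[leLHS](powRr0 d%:R) ler_powR ?ler1n //; lra.
have L_ge : l2 <= L.
  rewrite ge0_ler_powR ?nnegrE ?ln_ge0 ?ler1n //; first lra.
  by rewrite ler_ln ?posrE ?ltr0n // ler_nat.
have L_ge0 : 0 <= L by apply: powR_ge0.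
rewrite mulrDl [X in _ + X]mulrDl.
have [small_d|large_d] := ltnP d d0.
  apply: (@le_trans _ _ small).
    rewrite ler_nat; apply: (@leq_trans (2 * (d + t * d)).+1); last first.
      by rewrite ltnS leq_mul2l leq_add ?leq_mul2l ?(ltnW small_d) ?orbT.
    apply/arboricity_le/greedy_colorable => // [|v]; first exact: arc_irr.
    by apply: leq_trans (outd v) _; rewrite leq_mul2r (leq_trans (leq_subr _ _)) ?orbT.
  rewrite addrA ler_wpDl //; first by rewrite addr_ge0 // !mulr_ge0 // ltW // (lt_le_trans ltr01).
  apply: (@le_trans _ _ (small / l2 * 1 * l2)); first by rewrite mulr1 divfK ?gt_eqF.
  by apply: ler_pM => //; [rewrite mulr1 | exact: ltW | rewrite ler_wpM2l].
have [big1 big2] := d0P d large_d.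
have [m [k [w [m_gt0 mtd w_ge1 wk total]]]] := coloring_parameters R big1 big2.
have [|phi [phi_in phi_out]] := uncrowded_coloring ft ind outd t_gt0 d_gt0 _ mtd w_ge1 wk.
  by rewrite double_gt0.
rewrite addrA; apply: (@le_trans _ _ (d%:R + c1 * E * L)); last first.
  have E_ge0 : 0 <= E by apply: le_trans E_ge1.
  by rewrite lerDl mulr_ge0 // mulr_ge0.
apply: le_trans total; rewrite ler_nat.
apply/arboricity_le/(partition_colorable (phi := fun v => phi v)) => // [|v j|v j].
- exact: arc_irr.
- have [jp|jp] := ltnP j m.*2; first exact: (phi_in v (Ordinal jp)).
  rewrite (_ : [set u | _ & _] = set0) ?cards0 //; apply/setP => u; rewrite !inE.
  by apply/negP => /andP[_ /eqP uj]; move: jp; rewrite -uj leqNgt ltn_ord.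
- have [jp|jp] := ltnP j m.*2; first exact: (phi_out v (Ordinal jp)).
  rewrite (_ : [set u | _ & _] = set0) ?cards0 //; apply/setP => u; rewrite !inE.
  by apply/negP => /andP[_ /eqP uj]; move: jp; rewrite -uj leqNgt ltn_ord.
Qed.
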